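(* Let $M\subset \mathrm{Vec}^{c}(\mathbb{A}^2)$ be a Lie subalgebra isomorphic to $\mathfrak{aff}_2$. Then there is an étale map $\alpha$ such that $M=\alpha(\mathfrak{aff}_2)$. More precisely, if $f,g\in K[x,y]$ are such that $(D_f,D_g)$ is a basis of $\mathrm{rad}([M,M])$, then $$M=\langle D_f,D_g,fD_f,gD_g,gD_f,fD_g\rangle,$$ and one can take $\alpha=(f,g)$ (that is, $(f,g)$ is étale and $M=\alpha(\mathfrak{aff}_2)$ for $\alpha=(f,g)$).
   Context: $K$ is an algebraically closed field of characteristic zero and $\mathbb{A}^2=K^2$. $\mathrm{Vec}(\mathbb{A}^2)=\{p\,\partial_x+q\,\partial_y \mid p,q\in K[x,y]\}=\mathrm{Der}_K(K[x,y])$ is the Lie algebra of polynomial vector fields, $\mathrm{div}(p\,\partial_x+q\,\partial_y)=p_x+q_y$, and $\mathrm{Vec}^{c}(\mathbb{A}^2)=\{D\mid \mathrm{div}\,D\in K\}$. For $h\in K[x,y]$, $D_h:=h_x\partial_y-h_y\partial_x$. $\langle\cdots\rangle$ denotes $K$-linear span, and $\mathrm{rad}$ denotes the solvable radical of a Lie algebra. $\mathfrak{aff}_2$ is the Lie algebra of the group of affine transformations of $\mathbb{A}^2$, identified with $\langle \partial_x,\partial_y,x\partial_x+y\partial_y,x\partial_x-y\partial_y,x\partial_y,y\partial_x\rangle\subset \mathrm{Vec}^c(\mathbb{A}^2)$. For a $K$-algebra endomorphism $\alpha$ of $K[x,y]$ write $\alpha=(f,g)$ if $\alpha(x)=f$,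 $\alpha(y)=g$, and put $j(\alpha)=f_xg_y-f_yg_x$. $\alpha$ is étale if $j(\alpha)\in K^*$. An étale $\alpha=(f,g)$ induces an injective Lie algebra homomorphism $\mathrm{Vec}(\mathbb{A}^2)\to \mathrm{Vec}(\mathbb{A}^2)$, $D\mapsto\alpha(D)$, given for $D=p\,\partial_x+q\,\partial_y$ by $$\alpha(D)=\frac{1}{j(\alpha)}\Big(\big(g_y\alpha(p)-f_y\alpha(q)\big)\partial_x+\big(-g_x\alpha(p)+f_x\alpha(q)\big)\partial_y\Big);$$ it satisfies $\alpha(D)\circ\alpha=\alpha\circ D$. *)

(* Defs.v *)
From HB Require Import structures.
From mathcomp Require Import all_boot all_order all_algebra.
From mathcomp Require Import mpoly.

Set Implicit Arguments.
Unset Strict Implicit.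
Unset Printing Implicit Defensive.

Import GRing.Theory.
Local Open Scope ring_scope.

Notation Poly2 K := {mpoly K[2]}.

(* The pair (p, q) stands for the vector field p d/dx + q d/dy. *)
Notation Vec K := (Poly2 K * Poly2 K)%type.

Section Defs.
Variable K : closedFieldType.

Definition vx : Poly2 K := 'X_(@ord0 1).
Definition vy : Poly2 K := 'X_(@ord_max 1).

Definition dx (p : Poly2 K) : Poly2 K := mderiv ord0 p.
Definition dy (p : Poly2 K) : Poly2 K := mderiv ord_max p.

(* The derivation of K[x,y] given by a vector field, and the commutator of two
   such derivations. *)
Definition vact (D : Vec K) (h : Poly2 K) : Poly2 K := D.1 * dx h + D.2 * dy h.

Definition lie (D E : Vec K) : Vec K :=
  (vact D E.1 - vact E D.1, vact D E.2 - vact E D.2).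

Definition divergence (D : Vec K) : Poly2 K := dx D.1 + dy D.2.

Definition Vecc (D : Vec K) : Prop := exists c : K, divergence D = c%:MP.

Definition ham (h : Poly2 K) : Vec K := (- dy h, dx h).

Definition lspan (S : Vec K -> Prop) (v : Vec K) : Prop :=
  exists n (c : 'I_n -> K) (u : 'I_n -> Vec K),
    (forall i, S (u i)) /\ v = \sum_i c i *: u i.

Definition lspan_seq (s : seq (Vec K)) : Vec K -> Prop := lspan (fun v => v \in s).

Definition is_basis n (e : n.-tuple (Vec K)) (W : Vec K -> Prop) : Prop :=
  (forall c : 'I_n -> K, \sum_i c i *: tnth e i = 0 -> forall i, c i = 0) /\
  (forall v, W v <-> lspan_seq e v).

Definition is_subspace (W : Vec K -> Prop) : Prop :=
  W 0 /\ forall (c : K) u v, W u -> W v -> W (c *: u + v).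

Definition lie_subalgebra (L : Vec K -> Prop) : Prop :=
  is_subspace L /\ forall D E, L D -> L E -> L (lie D E).

Definition lie_ideal (I L : Vec K -> Prop) : Prop :=
  [/\ is_subspace I, forall D, I D -> L D &
      forall D E, L D -> I E -> I (lie D E)].

Definition lie_derived (L : Vec K -> Prop) : Vec K -> Prop :=
  lspan (fun B => exists D E, [/\ L D, L E & B = lie D E]).

Definition lie_solvable (L : Vec K -> Prop) : Prop :=
  exists n, forall D, iter n lie_derived L D -> D = 0.

(* The sum of all solvable ideals of L; it is the largest solvable ideal when
   L has finite dimension. *)
Definition lie_rad (L : Vec K -> Prop) : Vec K -> Prop :=
  lspan (fun D => exists I, [/\ lie_ideal I L, lie_solvable I & I D]).

(* Only the values of phi on L matter. *)
Definition lie_isomorphic (L L' : Vec K -> Prop) : Prop :=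
  exists phi : Vec K -> Vec K,
    [/\ forall (c : K) D E, L D -> L E -> phi (c *: D + E) = c *: phi D + phi E,
        forall D E, L D -> L E -> phi (lie D E) = lie (phi D) (phi E),
        forall D E, L D -> L E -> phi D = phi E -> D = E &
        forall D', L' D' <-> exists2 D, L D & phi D = D'].

Definition aff2 : Vec K -> Prop :=
  lspan_seq [:: (1, 0); (0, 1); (vx, vy); (vx, - vy); (0, vx); (vy, 0)].

Definition jac (alpha : {lrmorphism Poly2 K -> Poly2 K}) : Poly2 K :=
  let f := alpha vx in let g := alpha vy in dx f * dy g - dy f * dx g.

Definition etale (alpha : {lrmorphism Poly2 K -> Poly2 K}) : Prop :=
  exists2 c : K, c != 0 & jac alpha = c%:MP.

(* The inverse below is that of the ring K[x,y]; jac alpha is a unit as soon as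
   alpha is etale. *)
Definition vmap (alpha : {lrmorphism Poly2 K -> Poly2 K}) (D : Vec K) : Vec K :=
  let f := alpha vx in let g := alpha vy in
  ((jac alpha)^-1 * (dy g * alpha D.1 - dy f * alpha D.2),
   (jac alpha)^-1 * (- dx g * alpha D.1 + dx f * alpha D.2)).

Definition vimage (alpha : {lrmorphism Poly2 K -> Poly2 K})
    (L : Vec K -> Prop) (D : Vec K) : Prop :=
  exists2 E, L E & D = vmap alpha E.

(* The product p D of a polynomial and a vector field. *)
Definition pscale (p : Poly2 K) (D : Vec K) : Vec K := (p * D.1, p * D.2).

End Defs.

Arguments aff2 : clear implicits.

(* Main.v *)
Require Import Defs.
From mathcomp Require Import all_boot all_order all_algebra.
From mathcomp Require Import mpoly ring.

Set Implicit Arguments.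
Unset Strict Implicit.
Unset Printing Implicit Defensive.

Import GRing.Theory.
Local Open Scope ring_scope.

(** Throughout, [ham h] is the Hamiltonian field D_h, and [wedge] is the
    determinant of two vector fields, so that the Jacobian of (f, g) is
    [wedge (ham f) (ham g)].

    Transport the affine fields to M by the given isomorphism, and let A, B, E, F
    be the elements of M that correspond to d/dx, d/dy, x d/dy, y d/dx.
    Commutators of fields of constant divergence are divergence-free, so these
    four are divergence-free. The commutator of two divergence-free fields is the
    Hamiltonian field of their determinant; hence A = [B, F] and B = [A, E] come
    with explicit Hamiltonians f and g, and no integration of closed forms is
    needed. As [A, B] = 0, the Jacobian of (f, g) is a constant c.

    The heart of the matter is that c is not zero [param_nondegenerate]. The
    bracket relations say that E f = c1 - g, F g = c4 - f, and that E g and F f are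
    constants. Since E f * F g - E g * F f is a multiple of the Jacobian, c = 0
    would make (g - c1)(f - c4) constant, which forces f or g to be constant and
    hence A = 0 or B = 0.

    Once c is a nonzero constant, (A, B) is a frame of the K[x,y]-module of
    vector fields, and a field whose brackets with A and B have constant
    coordinates in this frame has itself coordinates of degree at most one in f
    and g [affine_of_brackets]. All elements of M have this property, and all
    constant brackets are realized in M, so that M is the set of the fields u A + v B
    with u, v in <1, f, g> [param_frame]; this is also the image of aff_2 under
    (f, g) [etale_image].

    It remains to compare (f, g) with an arbitrary pair of Hamiltonians of a basis
    of rad [M, M]. The derived algebra [M, M] corresponds to sl_2 + K^2, which is
    perfect, and in which an ideal not contained in K^2 is everything; so its
    radical is <A, B> [rad_param]. The two pairs then differ by an affine
    substitution, which preserves the description of M. *)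

Section Calculus.
Variable K : closedFieldType.
Implicit Types (a b c d k l p q r s t : K) (f g h : Poly2 K) (D E V : Vec K).

(** * Partial derivatives and Hamiltonian fields *)

Lemma dxD f g : dx (f + g) = dx f + dx g. Proof. exact: mderivD. Qed.
Lemma dyD f g : dy (f + g) = dy f + dy g. Proof. exact: mderivD. Qed.
Lemma dxN f : dx (- f) = - dx f. Proof. exact: mderivN. Qed.
Lemma dyN f : dy (- f) = - dy f. Proof. exact: mderivN. Qed.
Lemma dxM f g : dx (f * g) = dx f * g + f * dx g. Proof. exact: mderivM. Qed.
Lemma dyM f g : dy (f * g) = dy f * g + f * dy g. Proof. exact: mderivM. Qed.
Lemma dxC c : dx c%:MP = 0. Proof. exact: mderivC. Qed.
Lemma dyC c : dy c%:MP = 0. Proof. exact: mderivC. Qed.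
Lemma dx0 : dx (0 : Poly2 K) = 0. Proof. exact: mderiv0. Qed.
Lemma dy0 : dy (0 : Poly2 K) = 0. Proof. exact: mderiv0. Qed.
Lemma dx1 : dx (1 : Poly2 K) = 0. Proof. by rewrite -mpolyC1 dxC. Qed.
Lemma dy1 : dy (1 : Poly2 K) = 0. Proof. by rewrite -mpolyC1 dyC. Qed.
Lemma dydx f : dy (dx f) = dx (dy f). Proof. exact: mderiv_comm. Qed.

Lemma mderivXU (i j : 'I_2) : mderiv i ('X_j : Poly2 K) = (i == j)%:R.
Proof.
rewrite mderivX mnm1E (eq_sym j i); case: eqP => [->|_]; last by rewrite scale0r.
rewrite scale1r; suff -> : (U_(j) - U_(j) = 0 :> 'X_{1..2})%MM by rewrite mpolyX0.
by apply/mnmP => k; rewrite mnmBE subnn mnm0E.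
Qed.

Lemma dx_vx : dx (vx K) = 1. Proof. exact: mderivXU. Qed.
Lemma dy_vx : dy (vx K) = 0. Proof. exact: mderivXU. Qed.
Lemma dx_vy : dx (vy K) = 0. Proof. exact: mderivXU. Qed.
Lemma dy_vy : dy (vy K) = 1. Proof. exact: mderivXU. Qed.

Definition derivE := (dxD, dyD, dxN, dyN, dxM, dyM, dxC, dyC, dx0, dy0, dx1, dy1,
  dydx, dx_vx, dy_vx, dx_vy, dy_vy).

Lemma vec_eq D E : D.1 = E.1 -> D.2 = E.2 -> D = E.
Proof. by case: D E => [? ?] [? ?] /= -> ->. Qed.

(** Characteristic zero enters through the exponent that differentiation puts in
    front of a coefficient. *)
Lemma constant_of_partials h : [pchar K] =i pred0 ->
  dx h = 0 -> dy h = 0 -> exists c, h = c%:MP.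
Proof.
move=> charK dxh dyh; exists h@_0; apply/mpolyP => m; rewrite mcoeffC.
have coef0 (i : 'I_2) : mderiv i h = 0 -> m i != 0%N -> h@_m = 0.
  move=> dh; case mi: (m i) => [//|k] _.
  have le: (U_(i) <= m)%MM by apply/mnm_lepP => j; rewrite mnm1E; case: eqP => // <-;
    rewrite mi.
  have := congr1 (fun p : Poly2 K => p@_(m - U_(i))) dh.
  rewrite mcoeff_mderiv submK // mcoeff0 mnmBE mnm1E eqxx mi subn1 /= -mulr_natl.
  by move/eqP; rewrite mulf_eq0 (pcharf0P K).1 //= => /eqP.
case: eqP => [<-|/eqP]; first by rewrite mulr1.
rewrite mulr0 => m0.
case: (eqVneq (m ord0) 0%N) => [m00|/coef0]; last exact.
case: (eqVneq (m ord_max) 0%N) => [m10|/coef0]; last exact.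
case/eqP: m0; apply/mnmP => i; rewrite mnm0E.
by case: i => [[|[|//]] i2]; [rewrite -[RHS]m00|rewrite -[RHS]m10]; congr (m _);
  apply: val_inj.
Qed.

Lemma ham0_constant h : [pchar K] =i pred0 -> ham h = 0 -> exists c, h = c%:MP.
Proof.
move=> charK h0; apply: constant_of_partials => //;
  first exact: (congr1 (fun D : Vec K => D.2) h0).
by apply: oppr_inj; rewrite oppr0; exact: (congr1 (fun D : Vec K => D.1) h0).
Qed.

Definition wedge D E : Poly2 K := D.1 * E.2 - D.2 * E.1.

(** Divergence-free fields act on Hamiltonian fields through their action on the
    Hamiltonian: their flows preserve the area form. *)
Lemma lie_ham E h : divergence E = 0 -> lie E (ham h) = ham (vact E h).
Proof.
rewrite /divergence => /eqP; rewrite addr_eq0 => /eqP divE.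
by apply: vec_eq; rewrite /= /vact /= !derivE divE; ring.
Qed.

(** Cartan's formula: contracting the area form with two divergence-free fields
    gives a Hamiltonian of their bracket. This provides potentials for the
    elements of a derived algebra. *)
Lemma lie_ham_wedge D E : divergence D = 0 -> divergence E = 0 ->
  lie D E = ham (wedge D E).
Proof.
rewrite /divergence => /eqP; rewrite addr_eq0 => /eqP divD.
move=> /eqP; rewrite addr_eq0 => /eqP divE.
by apply: vec_eq; rewrite /= /wedge /vact /= !derivE divD divE; ring.
Qed.

Lemma divergence_lie D E :
  divergence (lie D E) = vact D (divergence E) - vact E (divergence D).
Proof. by rewrite /divergence /vact /= /vact !derivE; ring. Qed.

Lemma divergence_lie_Vecc D E : Vecc D -> Vecc E -> divergence (lie D E) = 0.
Proof.
by move=> [c cD] [d dE]; rewrite divergence_lie cD dE /vact !derivE; ring.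
Qed.

(** The Pluecker relation in dimension two. When f and g have Jacobian zero it
    gives E f * F g = E g * F f, the obstruction used in
    [param_nondegenerate]. *)
Lemma vact_plucker E F f g :
  vact E f * vact F g - vact E g * vact F f = wedge E F * wedge (ham f) (ham g).
Proof. by rewrite /vact /wedge /=; ring. Qed.

Lemma lieC D E : lie E D = - lie D E.
Proof. by apply: vec_eq; rewrite /=; ring. Qed.

(** * Linear spans of vector fields *)

Implicit Types (S L I : Vec K -> Prop).

Lemma subspaceZ (W : Vec K -> Prop) c v : is_subspace W -> W v -> W (c *: v).
Proof. by case=> W0 Wlin Wv; rewrite -[_ *: _]addr0; apply: Wlin. Qed.

Lemma subspaceD (W : Vec K -> Prop) u v : is_subspace W -> W u -> W v -> W (u + v).
Proof. by case=> W0 Wlin Wu Wv; rewrite -[u]scale1r; apply: Wlin. Qed.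

Lemma lspan_min S (W : Vec K -> Prop) : is_subspace W -> (forall v, S v -> W v) ->
  forall v, lspan S v -> W v.
Proof.
move=> subW SW _ [n [c [u [Su ->]]]].
elim/big_ind: _ => [|x y|i _]; first exact: subW.1.
- exact: subspaceD.
- by apply: subspaceZ => //; apply: SW.
Qed.

Lemma lspan_mem S v : S v -> lspan S v.
Proof.
move=> Sv; exists 1%N, (fun=> 1), (fun=> v); split=> //.
by rewrite big_ord1 scale1r.
Qed.

Lemma lspan_subspace S : is_subspace (lspan S).
Proof.
split.
  by exists 0%N, (fun=> 0), (fun=> 0); split=> [[]//|]; rewrite big_ord0.
move=> c _ _ [n [a [u [Su ->]]]] [m [b [w [Sw ->]]]].
exists (n + m)%N, (fun i => match split i with inl j => c * a j | inr k => b k end),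
  (fun i => match split i with inl j => u j | inr k => w k end).
split=> [i|]; first by case: (split i).
rewrite big_split_ord scaler_sumr; congr (_ + _); apply: eq_bigr => i _.
  by rewrite (unsplitK (inl i)) scalerA.
by rewrite (unsplitK (inr i)).
Qed.

Lemma lspan_mono S (W : Vec K -> Prop) : (forall v, S v -> W v) ->
  forall v, lspan S v -> lspan W v.
Proof.
by move=> SW; apply: lspan_min => [|v /SW]; [exact: lspan_subspace|exact: lspan_mem].
Qed.

Lemma lie_derived_mono L I : (forall v, L v -> I v) ->
  forall v, lie_derived L v -> lie_derived I v.
Proof.
move=> LI; apply: lspan_mono => _ [D [E [LD LE ->]]].
by exists D, E; split=> //; apply: LI.
Qed.

(** * Fields with affine coordinates in a frame *)

Definition affine_comb f g a b c : Poly2 K := a%:MP + b%:MP * f + c%:MP * g.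

Definition affine_frame f g D E V : Prop := exists a b c a' b' c',
  V = pscale (affine_comb f g a b c) D + pscale (affine_comb f g a' b' c') E.

Lemma affine_frame_subspace f g D E : is_subspace (affine_frame f g D E).
Proof.
split; first by exists 0, 0, 0, 0, 0, 0; apply: vec_eq; rewrite /= /affine_comb; ring.
move=> k _ _ [a [b [c [a' [b' [c' ->]]]]]] [r [s [t [r' [s' [t' ->]]]]]].
exists (k * a + r), (k * b + s), (k * c + t), (k * a' + r'), (k * b' + s'), (k * c' + t').
by apply: vec_eq; rewrite /= /affine_comb -mul_mpolyC; ring.
Qed.

Lemma affine_frame_span f g D E V :
  affine_frame f g D E V <->
  lspan_seq [:: D; E; pscale f D; pscale g E; pscale g D; pscale f E] V.
Proof.
split.
  move=> [a [b [c [a' [b' [c' ->]]]]]].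
  have -> : pscale (affine_comb f g a b c) D + pscale (affine_comb f g a' b' c') E =
    a *: D + (a' *: E + (b *: pscale f D + (c' *: pscale g E +
      (c *: pscale g D + b' *: pscale f E)))).
    by apply: vec_eq; rewrite /= /affine_comb -!mul_mpolyC; ring.
  set s := [:: D; E; pscale f D; pscale g E; pscale g D; pscale f E].
  have sub : is_subspace (lspan_seq s) := lspan_subspace _.
  have mem i : (i < size s)%N -> lspan_seq s (nth 0 s i).
    by move=> i_s; apply: lspan_mem; apply: mem_nth.
  apply: (subspaceD sub); first exact/(subspaceZ _ sub)/(mem 0%N).
  apply: (subspaceD sub); first exact/(subspaceZ _ sub)/(mem 1%N).
  apply: (subspaceD sub); first exact/(subspaceZ _ sub)/(mem 2%N).
  apply: (subspaceD sub); first exact/(subspaceZ _ sub)/(mem 3%N).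
  by apply: (subspaceD sub);
    [exact/(subspaceZ _ sub)/(mem 4%N)|exact/(subspaceZ _ sub)/(mem 5%N)].
apply: lspan_min => [|v]; first exact: affine_frame_subspace.
by rewrite !inE => /or4P[|||/or3P[]] /eqP ->;
  [exists 1, 0, 0, 0, 0, 0|exists 0, 0, 0, 1, 0, 0|exists 0, 1, 0, 0, 0, 0
  |exists 0, 0, 0, 0, 0, 1|exists 0, 0, 1, 0, 0, 0|exists 0, 0, 0, 0, 1, 0];
  apply: vec_eq; rewrite /= /affine_comb; ring.
Qed.

(** The Leibniz rule for the determinant, whose last term is the effect of D on the
    area form. It computes the derivatives of Cramer's coordinates. *)
Lemma vact_wedge D V (W : Vec K) :
  vact D (wedge V W) =
    wedge (lie D V) W + wedge V (lie D W) + divergence D * wedge V W.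
Proof. by rewrite /vact /wedge /divergence /= /vact !derivE; ring. Qed.

Lemma divergence_ham h : divergence (ham h) = 0.
Proof. by rewrite /divergence /= !derivE; ring. Qed.

Lemma vact_ham f g : vact (ham f) g = wedge (ham f) (ham g).
Proof. by rewrite /vact /wedge /=; ring. Qed.

(** Cramer's rule: when the determinant of (D, E) is a nonzero constant, every
    field is a polynomial combination of D and E. *)
Lemma cramer D E V :
  pscale (wedge D E) V = pscale (wedge V E) D + pscale (wedge D V) E.
Proof. by apply: vec_eq; rewrite /= /wedge; ring. Qed.

Lemma pscaleA f g D : pscale f (pscale g D) = pscale (f * g) D.
Proof. by apply: vec_eq; rewrite /= mulrA. Qed.

Lemma pscaleDr f D E : pscale f (D + E) = pscale f D + pscale f E.
Proof. by apply: vec_eq; rewrite /= mulrDr. Qed.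

Lemma pscale1 D : pscale 1 D = D.
Proof. by apply: vec_eq; rewrite /= mul1r. Qed.

Lemma mpolyC_neq0 c : c != 0 -> (c%:MP : Poly2 K) != 0.
Proof. by rewrite mpolyC_eq0. Qed.

Section Coordinates.
Variables (f g : Poly2 K) (c : K).
Hypotheses (charK : [pchar K] =i pred0) (c0 : c != 0).
Hypothesis wfg : wedge (ham f) (ham g) = c%:MP.

(** The fields D_f and D_g span the partial derivatives up to the factor c. *)
Lemma constant_of_hams w : vact (ham f) w = 0 -> vact (ham g) w = 0 ->
  exists s, w = s%:MP.
Proof.
move=> fw gw; apply: constant_of_partials => //;
  apply: (mulfI (mpolyC_neq0 c0)); rewrite mulr0 -wfg.
- transitivity (dx g * vact (ham f) w - dx f * vact (ham g) w).
    by rewrite /wedge /vact /=; ring.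
  by rewrite fw gw; ring.
- transitivity (dy g * vact (ham f) w - dy f * vact (ham g) w).
    by rewrite /wedge /vact /=; ring.
  by rewrite fw gw; ring.
Qed.

(** Subtracting the affine expression with the prescribed derivatives leaves a
    function killed by D_f and D_g; here D_f g = c and D_g f = - c. *)
Lemma affine_of_hams u a b :
  vact (ham f) u = (c * b)%:MP -> vact (ham g) u = (- (c * a))%:MP ->
  exists s, u = affine_comb f g s a b.
Proof.
move=> fu gu.
have E : exists s, u - a%:MP * f - b%:MP * g = s%:MP.
  apply: constant_of_hams.
  - transitivity (vact (ham f) u - b%:MP * wedge (ham f) (ham g)).
      by rewrite /vact /wedge /= !derivE; ring.
    by rewrite fu wfg; ring.
  - transitivity (vact (ham g) u + a%:MP * wedge (ham f) (ham g)).
      by rewrite /vact /wedge /= !derivE; ring.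
    by rewrite gu wfg; ring.
have [s Es] := E; exists s.
by rewrite /affine_comb -Es; ring.
Qed.

(** Since D_f and D_g commute, bracketing V with them differentiates its
    coordinates in the frame (D_f, D_g). So constant brackets mean affine
    coordinates, and the brackets determine V up to <D_f, D_g>: the constant terms
    s, s' are free. The factors c, - c make a, b, a', b' the coefficients of f and
    g in these coordinates. *)
Lemma affine_of_brackets V a b a' b' :
  lie (ham f) V = (c * b) *: ham f + (c * b') *: ham g ->
  lie (ham g) V = (- (c * a)) *: ham f + (- (c * a')) *: ham g ->
  exists s s', V = pscale (affine_comb f g s a b) (ham f)
                 + pscale (affine_comb f g s' a' b') (ham g).
Proof.
move=> fV gV.
have lfg : lie (ham f) (ham g) = 0.
  rewrite lie_ham ?divergence_ham // vact_ham wfg.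
  by apply: vec_eq; rewrite /= !derivE ?oppr0.
have lgf : lie (ham g) (ham f) = 0 by rewrite lieC lfg oppr0.
have lxx h : lie (ham h) (ham h) = 0 by apply: vec_eq; rewrite /=; ring.
have cV : c^-1%:MP * c%:MP = 1 :> Poly2 K by rewrite -mpolyCM mulVf.
pose u : Poly2 K := c^-1%:MP * wedge V (ham g).
pose v : Poly2 K := c^-1%:MP * wedge (ham f) V.
have VE : V = pscale u (ham f) + pscale v (ham g).
  by rewrite -!pscaleA -pscaleDr -cramer wfg pscaleA cV pscale1.
have vactZ D k h : vact D (k%:MP * h) = k%:MP * vact D h.
  by rewrite /vact !derivE; ring.
have wedge0 D : wedge 0 D = 0 by rewrite /wedge /=; ring.
have wedger0 D : wedge D 0 = 0 by rewrite /wedge /=; ring.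
have wedge_l D E (W : Vec K) k l :
    wedge (k *: D + l *: E) W = k%:MP * wedge D W + l%:MP * wedge E W.
  by rewrite /wedge /= -!mul_mpolyC; ring.
have wedge_r D E (W : Vec K) k l :
    wedge W (k *: D + l *: E) = k%:MP * wedge W D + l%:MP * wedge W E.
  by rewrite /wedge /= -!mul_mpolyC; ring.
have wxx D : wedge D D = 0 by rewrite /wedge; ring.
have [|| s us] := @affine_of_hams u a b.
- rewrite /u vactZ vact_wedge divergence_ham lfg fV wedge_l wxx wedger0 wfg.
  transitivity ((c^-1%:MP * c%:MP : Poly2 K) * (c * b)%:MP); first by ring.
  by rewrite cV mul1r.
- rewrite /u vactZ vact_wedge divergence_ham lxx gV wedge_l wxx wedger0 wfg.
  transitivity ((c^-1%:MP * c%:MP : Poly2 K) * (- (c * a))%:MP); first by ring.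
  by rewrite cV mul1r.
have [|| s' vs] := @affine_of_hams v a' b'.
- rewrite /v vactZ vact_wedge divergence_ham lxx fV wedge_r wxx wedge0 wfg.
  transitivity ((c^-1%:MP * c%:MP : Poly2 K) * (c * b')%:MP); first by ring.
  by rewrite cV mul1r.
- rewrite /v vactZ vact_wedge divergence_ham lgf gV wedge_r wxx wedge0 wfg.
  transitivity ((c^-1%:MP * c%:MP : Poly2 K) * (- (c * a'))%:MP); first by ring.
  by rewrite cV mul1r.
by exists s, s'; rewrite -us -vs.
Qed.

End Coordinates.

Lemma lspan_pair D E V :
  lspan_seq [:: D; E] V <-> exists a b, V = a *: D + b *: E.
Proof.
split.
  apply: (@lspan_min _ (fun V => exists a b, V = a *: D + b *: E)) => [|v].
    split; first by exists 0, 0; rewrite !scale0r addr0.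
    move=> k _ _ [a [b ->]] [a' [b' ->]]; exists (k * a + a'), (k * b + b').
    by rewrite !scalerDl scalerDr !scalerA addrACA.
  rewrite !inE => /orP[] /eqP ->; [exists 1, 0|exists 0, 1];
    by rewrite scale1r scale0r ?addr0 ?add0r.
move=> [a [b ->]].
have sub : is_subspace (lspan_seq [:: D; E]) := lspan_subspace _.
by apply: (subspaceD sub); apply: (subspaceZ _ sub); apply: lspan_mem;
  rewrite !inE eqxx ?orbT.
Qed.

Lemma lspan_pair_mem D E : lspan_seq [:: D; E] D /\ lspan_seq [:: D; E] E.
Proof. by split; apply: lspan_mem; rewrite !inE eqxx ?orbT. Qed.

Lemma affine_of_ham_comb f g h a b : [pchar K] =i pred0 ->
  ham h = a *: ham f + b *: ham g -> exists s, h = affine_comb f g s a b.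
Proof.
move=> charK hE.
have /(ham0_constant charK) [s sE] : ham (h - a%:MP * f - b%:MP * g) = 0.
  transitivity (ham h - (a *: ham f + b *: ham g)); last by rewrite hE subrr.
  by apply: vec_eq; rewrite /= !derivE -!mul_mpolyC; ring.
by exists s; rewrite /affine_comb -sE; ring.
Qed.

(** A linear change of (D_f, D_g) is an affine change of (f, g), and both are
    absorbed by the affine coordinates. *)
Lemma affine_frame_change f g f' g' V : [pchar K] =i pred0 ->
  lspan_seq [:: ham f; ham g] (ham f') -> lspan_seq [:: ham f; ham g] (ham g') ->
  affine_frame f' g' (ham f') (ham g') V -> affine_frame f g (ham f) (ham g) V.
Proof.
move=> charK /lspan_pair [k [l Ef]] /lspan_pair [k' [l' Eg]].
have [s fE] := affine_of_ham_comb charK Ef; have [s' gE] := affine_of_ham_comb charK Eg.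
have comp a b c : exists r t w, affine_comb f' g' a b c = affine_comb f g r t w.
  exists (a + b * s + c * s'), (b * k + c * k'), (b * l + c * l').
  by rewrite fE gE /affine_comb; ring.
move=> [a [b [c [a' [b' [c' ->]]]]]].
have [r [t [w ->]]] := comp a b c; have [r' [t' [w' ->]]] := comp a' b' c'.
exists (r * k + r' * k'), (t * k + t' * k'), (w * k + w' * k'),
  (r * l + r' * l'), (t * l + t' * l'), (w * l + w' * l').
by rewrite Ef Eg; apply: vec_eq; rewrite /= /affine_comb -!mul_mpolyC; ring.
Qed.

(** * The Lie algebra of affine vector fields *)

Definition affine_field a b c a' b' c' : Vec K :=
  (affine_comb (vx K) (vy K) a b c, affine_comb (vx K) (vy K) a' b' c').

Ltac affine_ring := congr affine_field; ring.

Lemma lie_affine_field a b c a' b' c' (p q r p' q' r' : K) :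
  lie (affine_field a b c a' b' c') (affine_field p q r p' q' r') =
  affine_field (a * q + a' * r - p * b - p' * c) (b' * r - q' * c)
       (c * q + c' * r - r * b - r' * c)
       (a * q' + a' * r' - p * b' - p' * c') (b * q' + b' * r' - q * b' - q' * c')
       (c * q' - r * b').
Proof.
by apply: vec_eq; rewrite /= /vact /= /affine_comb !derivE; ring.
Qed.

Lemma affine_field_lin k a b c a' b' c' (p q r p' q' r' : K) :
  k *: affine_field a b c a' b' c' + affine_field p q r p' q' r' =
  affine_field (k * a + p) (k * b + q) (k * c + r)
    (k * a' + p') (k * b' + q') (k * c' + r').
Proof. by apply: vec_eq; rewrite /= /affine_comb -mul_mpolyC; ring. Qed.

Lemma affine_field0 : affine_field 0 0 0 0 0 0 = 0.
Proof. by apply: vec_eq; rewrite /= /affine_comb; ring. Qed.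

Lemma natr_neq0_char0 n : [pchar K] =i pred0 -> n.+1%:R != 0 :> K.
Proof. by move=> charK; rewrite (pcharf0P K).1. Qed.

Lemma aff2P D : [pchar K] =i pred0 ->
  aff2 K D <-> exists a b c a' b' c', D = affine_field a b c a' b' c'.
Proof.
move=> charK; have n2 := natr_neq0_char0 1 charK; split.
  apply: (@lspan_min _ (fun D =>
    exists a b c a' b' c', D = affine_field a b c a' b' c')) => [|v].
    split; first by exists 0, 0, 0, 0, 0, 0; rewrite affine_field0.
    move=> k _ _ [a [b [c [a' [b' [c' ->]]]]]] [r [s [t [r' [s' [t' ->]]]]]].
    by do 6 eexists; rewrite affine_field_lin.
  by rewrite !inE => /or4P[|||/or3P[]] /eqP ->;
   [exists 1, 0, 0, 0, 0, 0|exists 0, 0, 0, 1, 0, 0|exists 0, 1, 0, 0, 0, 1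
   |exists 0, 1, 0, 0, 0, (-1)|exists 0, 0, 0, 0, 1, 0|exists 0, 0, 1, 0, 0, 0];
   apply: vec_eq; rewrite /= /affine_comb; ring.
move=> [a [b [c [a' [b' [c' ->]]]]]]; rewrite /aff2; set s := (X in lspan_seq X).
have sub : is_subspace (lspan_seq s) := lspan_subspace _.
have mem i : (i < size s)%N -> lspan_seq s (nth 0 s i).
  by move=> i_s; apply: lspan_mem; apply: mem_nth.
have [m [n [-> ->]]] : exists m n, b = m + n /\ c' = m - n.
  by exists ((b + c') / 2), ((b - c') / 2); split; field.
have -> : affine_field a (m + n) c a' b' (m - n) = a *: s`_0 + (a' *: s`_1 + (m *: s`_2 +
    (n *: s`_3 + (b' *: s`_4 + c *: s`_5)))).
  by apply: vec_eq; rewrite /= /affine_comb -!mul_mpolyC; ring.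
apply: (subspaceD sub); first exact/(subspaceZ _ sub)/(mem 0%N).
apply: (subspaceD sub); first exact/(subspaceZ _ sub)/(mem 1%N).
apply: (subspaceD sub); first exact/(subspaceZ _ sub)/(mem 2%N).
apply: (subspaceD sub); first exact/(subspaceZ _ sub)/(mem 3%N).
by apply: (subspaceD sub);
  [exact/(subspaceZ _ sub)/(mem 4%N)|exact/(subspaceZ _ sub)/(mem 5%N)].
Qed.

(** The coefficients are recovered by operations that are linear on all of
    K[x,y], so that a linear map on affine fields extends to all fields. *)
Lemma affine_comb_coef a b c (u := affine_comb (vx K) (vy K) a b c) :
  [/\ u@_0 = a, (dx u)@_0 = b & (dy u)@_0 = c].
Proof.
have X0 (i : 'I_2) : ('X_i : Poly2 K)@_0 = 0.
  by rewrite mcoeffX mnm1_eq0.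
split; rewrite /u /affine_comb.
- by rewrite !mcoeffD !mcoeffCM mcoeffC eqxx /vx /vy !X0 mulr1 !mulr0 !addr0.
- have -> : dx (a%:MP + b%:MP * vx K + c%:MP * vy K) = b%:MP by rewrite !derivE; ring.
  by rewrite mcoeffC eqxx mulr1.
- have -> : dy (a%:MP + b%:MP * vx K + c%:MP * vy K) = c%:MP by rewrite !derivE; ring.
  by rewrite mcoeffC eqxx mulr1.
Qed.

(** * Subalgebras isomorphic to the affine one *)

Section Parametrization.
Hypothesis (charK : [pchar K] =i pred0).

(** An isomorphism in the direction opposite to [lie_isomorphic], so that elements
    of [M] are given by six scalars. Linearity on all vector fields, which costs
    nothing when psi is defined through coefficients, spares side conditions. *)
Definition aff2_param (M : Vec K -> Prop) (psi : Vec K -> Vec K) : Prop :=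
  [/\ forall k D E, psi (k *: D + E) = k *: psi D + psi E,
      forall D E, aff2 K D -> aff2 K E -> psi (lie D E) = lie (psi D) (psi E),
      forall D, aff2 K D -> psi D = 0 -> D = 0 &
      forall V, M V <-> exists2 D, aff2 K D & psi D = V].

Lemma aff2_affine_field a b c a' b' c' : aff2 K (affine_field a b c a' b' c').
Proof. by apply/(aff2P _ charK); exists a, b, c, a', b', c'. Qed.

Lemma aff2_param_exists (M : Vec K -> Prop) : lie_subalgebra M ->
  lie_isomorphic M (aff2 K) -> exists psi, aff2_param M psi.
Proof.
move=> [subM lieM] [phi [phi_lin phi_lie phi_inj phi_im]].
have lift D : aff2 K D -> exists2 V, M V & phi V = D by move/phi_im.
have [X1 M1 P1] := lift _ (aff2_affine_field 1 0 0 0 0 0).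
have [X2 M2 P2] := lift _ (aff2_affine_field 0 1 0 0 0 0).
have [X3 M3 P3] := lift _ (aff2_affine_field 0 0 1 0 0 0).
have [X4 M4 P4] := lift _ (aff2_affine_field 0 0 0 1 0 0).
have [X5 M5 P5] := lift _ (aff2_affine_field 0 0 0 0 1 0).
have [X6 M6 P6] := lift _ (aff2_affine_field 0 0 0 0 0 1).
have M0 : M 0 by case: subM.
have phi0 : phi 0 = 0.
  have := phi_lin 1 0 0 M0 M0; rewrite !scale1r addr0.
  by move/(congr1 (fun x => x - phi 0)); rewrite subrr addrK => <-.
have phiZ k V : M V -> phi (k *: V) = k *: phi V.
  by move=> MV; have := phi_lin k V 0 MV M0; rewrite phi0 !addr0.
have MZ k V : M V -> M (k *: V) by apply: subspaceZ.
have MD U V : M U -> M V -> M (U + V) by apply: subspaceD.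
(* The inverse of phi, through its values on a basis. *)
pose psi (D : Vec K) : Vec K :=
  D.1@_0 *: X1 + ((dx D.1)@_0 *: X2 + ((dy D.1)@_0 *: X3 +
  (D.2@_0 *: X4 + ((dx D.2)@_0 *: X5 + (dy D.2)@_0 *: X6)))).
have psiE a b c a' b' c' : psi (affine_field a b c a' b' c') =
   a *: X1 + (b *: X2 + (c *: X3 + (a' *: X4 + (b' *: X5 + c' *: X6)))).
  rewrite /psi /=; have [-> -> ->] := affine_comb_coef a b c.
  by have [-> -> ->] := affine_comb_coef a' b' c'.
have Mpsi D : M (psi D) by rewrite /psi; do 5![apply: (MD _ _); first exact: MZ];
  exact: MZ.
have psiK D : aff2 K D -> phi (psi D) = D.
  move=> /(aff2P _ charK) [a [b [c [a' [b' [c' ->]]]]]].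
  rewrite psiE !phi_lin ?phiZ //; try by do ?[exact: MZ | apply: (MD _ _);
    first exact: MZ].
  rewrite P1 P2 P3 P4 P5 P6; apply: vec_eq; rewrite /= /affine_comb -!mul_mpolyC; ring.
exists psi; split.
- move=> k D E; rewrite /psi /= !dxD !dyD /dx /dy !mderivZ !mcoeffD !mcoeffZ.
  rewrite !scalerDl !scalerDr !scalerA.
  by apply: vec_eq; rewrite /= -!mul_mpolyC; ring.
- move=> D E aD aE; apply: phi_inj => //; first exact: lieM.
  rewrite phi_lie // !psiK //.
  move: aD aE => /(aff2P _ charK) [a [b [c [a' [b' [c' ->]]]]]].
  move=> /(aff2P _ charK) [p [q [r [p' [q' [r' ->]]]]]].
  by rewrite lie_affine_field; apply: aff2_affine_field.
- by move=> D aD D0; rewrite -(psiK D aD) D0 phi0.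
- move=> V; split=> [MV|[D aD <-]]; last exact: Mpsi.
  have aV : aff2 K (phi V) by apply/phi_im; exists V.
  by exists (phi V) => //; apply: phi_inj => //; rewrite psiK.
Qed.

Section FixedIsomorphism.
Variables (M : Vec K -> Prop) (psi : Vec K -> Vec K).
Hypothesis psiP : aff2_param M psi.

Lemma param_lin k D E : psi (k *: D + E) = k *: psi D + psi E.
Proof. by case: psiP. Qed.

Lemma param0 : psi 0 = 0.
Proof.
have := param_lin 1 0 0; rewrite !scale1r addr0.
by move/(congr1 (fun x => x - psi 0)); rewrite subrr addrK => <-.
Qed.

Lemma paramZ k D : psi (k *: D) = k *: psi D.
Proof. by have := param_lin k D 0; rewrite param0 !addr0. Qed.

Lemma paramD D E : psi (D + E) = psi D + psi E.
Proof. by have := param_lin 1 D E; rewrite !scale1r. Qed.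

Lemma lie_param a b c a' b' c' (p q r p' q' r' : K) :
  lie (psi (affine_field a b c a' b' c')) (psi (affine_field p q r p' q' r')) =
  psi (lie (affine_field a b c a' b' c') (affine_field p q r p' q' r')).
Proof. by case: psiP => _ -> //; apply: aff2_affine_field. Qed.

Lemma paramP V : M V <-> exists a b c a' b' c', V = psi (affine_field a b c a' b' c').
Proof.
case: psiP => _ _ _ MP; split.
  by move=> /MP [D /(aff2P _ charK) [a [b [c [a' [b' [c' ->]]]]]] <-]; do 6 eexists.
by move=> [a [b [c [a' [b' [c' ->]]]]]]; apply/MP;
  exists (affine_field a b c a' b' c') => //; apply: aff2_affine_field.
Qed.

(** The commuting fields d/dx and d/dy go to Hamiltonian fields with constant
    Jacobian c. The images of x d/dy and y d/dx exclude c = 0: otherwise the product of f and g,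
    each shifted by a constant, would be constant. *)
Lemma param_nondegenerate : (forall V, M V -> Vecc V) ->
  exists f g c, [/\ c != 0, psi (affine_field 1 0 0 0 0 0) = ham f,
    psi (affine_field 0 0 0 1 0 0) = ham g & wedge (ham f) (ham g) = c%:MP].
Proof.
move=> divM; have n2 := natr_neq0_char0 1 charK.
have div0 a b c a' b' c' (p q r p' q' r' : K) :
    divergence (psi (lie (affine_field a b c a' b' c') (affine_field p q r p' q' r'))) = 0.
  rewrite -lie_param; apply: divergence_lie_Vecc; apply: divM; apply/paramP;
    by do 6 eexists.
have lieE a b c a' b' c' (p q r p' q' r' : K) V :
    lie (affine_field a b c a' b' c') (affine_field p q r p' q' r') = V ->
    divergence (psi V) = 0.
  by move=> <-.
set A := psi (affine_field 1 0 0 0 0 0); set B := psi (affine_field 0 0 0 1 0 0).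
pose E := psi (affine_field 0 0 0 0 1 0); pose F := psi (affine_field 0 0 1 0 0 0).
have divE : divergence E = 0.
  (* x d/dy is an eigenvector, with eigenvalue 2, of x d/dx - y d/dy. *)
  apply: (lieE 0 (2^-1) 0 0 0 (- 2^-1) 0 0 0 0 1 0); rewrite lie_affine_field.
  by congr affine_field; field.
have divF : divergence F = 0.
  apply: (lieE 0 (- 2^-1) 0 0 0 (2^-1) 0 0 1 0 0 0); rewrite lie_affine_field.
  by congr affine_field; field.
have BF : lie B F = A by rewrite lie_param lie_affine_field; congr psi; affine_ring.
have AE : lie A E = B by rewrite lie_param lie_affine_field; congr psi; affine_ring.
have BE : lie B E = 0.
  by rewrite lie_param lie_affine_field -param0 -affine_field0; congr psi; affine_ring.
have AF : lie A F = 0.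
  by rewrite lie_param lie_affine_field -param0 -affine_field0; congr psi; affine_ring.
have AB : lie A B = 0.
  by rewrite lie_param lie_affine_field -param0 -affine_field0; congr psi; affine_ring.
have divA : divergence A = 0.
  by apply: (lieE 0 0 0 1 0 0 0 0 1 0 0 0); rewrite lie_affine_field; affine_ring.
have divB : divergence B = 0.
  by apply: (lieE 1 0 0 0 0 0 0 0 0 0 1 0); rewrite lie_affine_field; affine_ring.
pose f := wedge B F; pose g := wedge A E.
have Af : A = ham f by rewrite -lie_ham_wedge.
have Bg : B = ham g by rewrite -lie_ham_wedge.
have hamD h h' : ham (h + h') = ham h + ham h' :> Vec K.
  by apply: vec_eq; rewrite /= !derivE; ring.
have neqv a b c a' b' c' : psi (affine_field a b c a' b' c') = 0 ->
    affine_field a b c a' b' c' = 0.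
  by case: psiP => _ _ inj _; apply: inj; apply: aff2_affine_field.
have affine_field_inj a a' : affine_field a 0 0 a' 0 0 = 0 -> a = 0 /\ a' = 0.
  move=> H; split.
    have := congr1 (fun D : Vec K => D.1@_0) H; rewrite /= mcoeff0.
    by have [-> _ _] := affine_comb_coef a 0 0.
  have := congr1 (fun D : Vec K => D.2@_0) H; rewrite /= mcoeff0.
  by have [-> _ _] := affine_comb_coef a' 0 0.
have A0 : A != 0.
  by apply/eqP => /neqv/affine_field_inj [] /eqP; rewrite oner_eq0.
have B0 : B != 0.
  by apply/eqP => /neqv/affine_field_inj [] _ /eqP; rewrite oner_eq0.
have ham_unit h c : h + c%:MP \is a GRing.unit -> ham h = 0.
  rewrite unfold_in /= => /andP [/eqP hc _].
  have -> : h = ((h + c%:MP)@_0 - c)%:MP by rewrite mpolyCB -hc addrK.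
  by apply: vec_eq; rewrite /= !derivE ?oppr0.
have [c wc] : exists c, wedge A B = c%:MP.
  by apply: (ham0_constant charK); rewrite -lie_ham_wedge.
exists f, g, c; split; rewrite -?Af -?Bg //.
apply: contraNneq A0 => c0; move: wc; rewrite c0 mpolyC0 => wAB.
have [c1 fE] : exists c1, vact E f + g = c1%:MP.
  apply: (ham0_constant charK); rewrite hamD -lie_ham // -Af -Bg lieC AE.
  by rewrite addNr.
have [c2 gE] : exists c2, vact E g = c2%:MP.
  by apply: (ham0_constant charK); rewrite -lie_ham // -Bg lieC BE oppr0.
have [c3 fF] : exists c3, vact F f = c3%:MP.
  by apply: (ham0_constant charK); rewrite -lie_ham // -Af lieC AF oppr0.
have [c4 gF] : exists c4, vact F g + f = c4%:MP.
  apply: (ham0_constant charK); rewrite hamD -lie_ham // -Af -Bg lieC BF.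
  by rewrite addNr.
have := vact_plucker E F f g; rewrite -Af -Bg wAB mulr0 gE fF.
have -> : vact E f = - (g + (- c1)%:MP) by rewrite mpolyCN -fE; ring.
have -> : vact F g = - (f + (- c4)%:MP) by rewrite mpolyCN -gF; ring.
rewrite mulrNN -mpolyCM => /eqP; rewrite subr_eq0 => /eqP prod.
case: (eqVneq (c2 * c3) 0) => c23.
  move: prod; rewrite c23 mpolyC0 => /eqP; rewrite mulf_eq0 => /orP[] /eqP.
    rewrite mpolyCN => /subr0_eq gc; case/eqP: B0; rewrite Bg gc.
    by apply: vec_eq; rewrite /= !derivE ?oppr0.
  rewrite mpolyCN => /subr0_eq fc; rewrite Af fc.
  by apply/eqP; apply: vec_eq; rewrite /= !derivE ?oppr0.
have : (c2 * c3)%:MP \is a @GRing.unit (Poly2 K).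
  by rewrite rmorph_unit // unitfE.
by rewrite -prod unitrM => /andP [_ /ham_unit fh]; rewrite Af fh.
Qed.

(** Brackets with the translations kill translations and turn the linear part
    into arbitrary constants; hence both inclusions follow from
    [affine_of_brackets]. *)
Lemma param_frame f g c : c != 0 -> psi (affine_field 1 0 0 0 0 0) = ham f ->
  psi (affine_field 0 0 0 1 0 0) = ham g -> wedge (ham f) (ham g) = c%:MP ->
  forall V, M V <-> affine_frame f g (ham f) (ham g) V.
Proof.
move=> c0 Ef Eg wc.
(* Splitting off the translation part. *)
have transl a b a' b' c1 c1' :
    psi (affine_field a b c1 a' b' c1') =
    a *: ham f + a' *: ham g + psi (affine_field 0 b c1 0 b' c1').
  rewrite -Ef -Eg -!paramZ -!paramD; congr psi.
  by apply: vec_eq; rewrite /= /affine_comb -!mul_mpolyC; ring.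
(* The linear part is chosen to have prescribed brackets with A and B. *)
have expand a b b' a' d d' : exists s s',
    psi (affine_field a (c * b) (- (c * d)) a' (c * b') (- (c * d'))) =
    pscale (affine_comb f g s d b) (ham f) + pscale (affine_comb f g s' d' b') (ham g).
  apply: (affine_of_brackets charK c0 wc).
  - rewrite -{1}Ef lie_param lie_affine_field.
    rewrite -[RHS]addr0 -param0 -affine_field0 -transl.
    by congr psi; affine_ring.
  - rewrite -{1}Eg lie_param lie_affine_field.
    rewrite -[RHS]addr0 -param0 -affine_field0 -transl.
    by congr psi; affine_ring.
move=> V; split.
  move=> /paramP [a [b [d [a' [b' [d' ->]]]]]].
  have [s [s' E]] := expand a (c^-1 * b) (c^-1 * b') a' (- (c^-1 * d)) (- (c^-1 * d')).
  exists s, (- (c^-1 * d)), (c^-1 * b), s', (- (c^-1 * d')), (c^-1 * b').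
  by rewrite -E; congr (psi (affine_field _ _ _ _ _ _)); field.
move=> [s [d [b [s' [d' [b' ->]]]]]].
have [t [t' E]] := expand 0 b b' 0 d d'.
apply/paramP; exists (s - t), (c * b), (- (c * d)), (s' - t'), (c * b'), (- (c * d')).
by rewrite transl E; apply: vec_eq; rewrite /= /affine_comb -!mul_mpolyC; ring.
Qed.

(** * The radical of the derived algebra *)

(** The copy in [M] of the divergence-free affine fields, sl_2 + K^2. *)
Definition param_saff V : Prop :=
  exists a b c a' b', V = psi (affine_field a b c a' b' (- b)).

Lemma param_saff_subspace : is_subspace param_saff.
Proof.
split; first by exists 0, 0, 0, 0, 0; rewrite oppr0 affine_field0 param0.
move=> k _ _ [a [b [c [a' [b' ->]]]]] [p [q [r [p' [q' ->]]]]].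
exists (k * a + p), (k * b + q), (k * c + r), (k * a' + p'), (k * b' + q').
by rewrite -param_lin affine_field_lin; congr psi; affine_ring.
Qed.

(** The semisimple element x d/dx - y d/dy has nonzero eigenvalues -1, 1, 2, -2 on
    d/dx, d/dy, x d/dy, y d/dx, and is itself the bracket of x d/dy and y d/dx. *)
Lemma param_saff_perfect V : param_saff V -> lie_derived param_saff V.
Proof.
have n2 := natr_neq0_char0 1 charK.
move=> [a [b [c [a' [b' ->]]]]].
pose S a b c a' b' := psi (affine_field a b c a' b' (- b)).
have Ssaff p q r p' q' : param_saff (S p q r p' q') by exists p, q, r, p', q'.
have -> : psi (affine_field a b c a' b' (- b)) =
    lie (S 0 1 0 0 0) (S (- a) 0 (- c / 2) a' (b' / 2)) +
    lie (S 0 0 0 0 1) (S 0 0 b 0 0).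
  rewrite /S !lie_param !lie_affine_field -paramD.
  rewrite -[X in psi (X + _)]scale1r affine_field_lin.
  congr psi.
  by congr affine_field; field.
have sub : is_subspace (lie_derived param_saff) := lspan_subspace _.
by apply: (subspaceD sub); apply: lspan_mem; (do 2 eexists; split; last by []);
  exact: Ssaff.
Qed.

Lemma derived_param V : lie_derived M V <-> param_saff V.
Proof.
split; last first.
  move/param_saff_perfect; apply: lie_derived_mono => {}V [a [b [c [a' [b' ->]]]]].
  by apply/paramP; do 6 eexists.
apply: lspan_min => [|W [D [E [/paramP [a [b [c [a' [b' [c' ->]]]]]]]]]].
  exact: param_saff_subspace.
move=> /paramP [p [q [r [p' [q' [r' ->]]]]]] ->.
rewrite lie_param lie_affine_field; do 5 eexists; congr (psi (affine_field _ _ _ _ _ _));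
  by ring.
Qed.

Definition param_translation V : Prop := exists a b, V = psi (affine_field a 0 0 b 0 0).

Lemma param_translation_subspace : is_subspace param_translation.
Proof.
split; first by exists 0, 0; rewrite affine_field0 param0.
move=> k _ _ [a [b ->]] [p [q ->]].
exists (k * a + p), (k * b + q).
by rewrite -param_lin affine_field_lin; congr psi; affine_ring.
Qed.

(** By the representation theory of sl_2 on sl_2 + K^2, an ideal with an element
    outside K^2 is everything. Concretely, brackets with x d/dy and y d/dx
    lead from such an element to a multiple of x d/dy, and x d/dy generates
    everything. *)
Lemma param_saff_ideal (I : Vec K -> Prop) V : is_subspace I ->
  (forall D E, param_saff D -> I E -> I (lie D E)) ->
  param_saff V -> I V ->
  param_translation V \/ forall W, param_saff W -> I W.
Proof.
move=> subI stab [a [b [c [a' [b' ->]]]]] IV.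
have n2 := natr_neq0_char0 1 charK.
pose J p q r p' q' := I (psi (affine_field p q r p' q' (- q))).
have Jlie p q r p' q' s t u s' t' s1 t1 u1 s1' t1' : J s t u s' t' ->
    lie (affine_field p q r p' q' (- q)) (affine_field s t u s' t' (- t)) =
      affine_field s1 t1 u1 s1' t1' (- t1) -> J s1 t1 u1 s1' t1'.
  move=> Jv E; rewrite /J -E -lie_param; apply: stab => //.
  by exists p, q, r, p', q'.
have Jlin k s t u s' t' p q r p' q' : J s t u s' t' -> J p q r p' q' ->
    J (k * s + p) (k * t + q) (k * u + r) (k * s' + p') (k * t' + q').
  move=> J1 J2; rewrite /J.
  have -> : - (k * t + q) = k * (- t) + - q by ring.
  by rewrite -affine_field_lin param_lin; apply: subI.2.
have J0 : J 0 0 0 0 0 by rewrite /J oppr0 affine_field0 param0; exact: subI.1.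
have JZ k s t u s' t' : J s t u s' t' -> J (k * s) (k * t) (k * u) (k * s') (k * t').
  by move=> J1; have := Jlin k _ _ _ _ _ _ _ _ _ _ J1 J0; rewrite !addr0.
(* x d/dy generates: its brackets give d/dy, x d/dx - y d/dy, y d/dx, d/dx. *)
have fromE k : k != 0 -> J 0 0 0 0 k -> forall W, param_saff W -> I W.
  move=> k0 Jk.
  have JE : J 0 0 0 0 1 by have := JZ k^-1 _ _ _ _ _ Jk; rewrite !mulr0 mulVf.
  have JB : J 0 0 0 1 0.
    by apply: (Jlie 1 0 0 0 0 _ _ _ _ _ _ _ _ _ _ JE); rewrite lie_affine_field;
      affine_ring.
  have JH : J 0 (-1) 0 0 0.
    by apply: (Jlie 0 0 1 0 0 _ _ _ _ _ _ _ _ _ _ JE); rewrite lie_affine_field;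
      affine_ring.
  have JF : J 0 0 (- 2) 0 0.
    by apply: (Jlie 0 0 1 0 0 _ _ _ _ _ _ _ _ _ _ JH); rewrite lie_affine_field;
      affine_ring.
  have JA : J (-1) 0 0 0 0.
    by apply: (Jlie 0 0 1 0 0 _ _ _ _ _ _ _ _ _ _ JB); rewrite lie_affine_field;
      affine_ring.
  move=> _ [p [q [r [p' [q' ->]]]]].
  have := Jlin (- p) _ _ _ _ _ _ _ _ _ _ JA (Jlin (- q) _ _ _ _ _ _ _ _ _ _ JH
    (Jlin (- r / 2) _ _ _ _ _ _ _ _ _ _ JF
    (Jlin p' _ _ _ _ _ _ _ _ _ _ JB (JZ q' _ _ _ _ _ JE)))).
  by rewrite /J; congr (I (psi (affine_field _ _ _ _ _ _))); field.
(* Without a y d/dx component, bracketing with x d/dy leaves only d/dy and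
   x d/dy, which x d/dx - y d/dy separates by their weights 1 and 2. *)
have fromH s s' t t' : t != 0 -> J s t 0 s' t' -> forall W, param_saff W -> I W.
  move=> t0 JD.
  have J1 : J 0 0 0 (- s) (- (2 * t)).
    by apply: (Jlie 0 0 0 0 1 _ _ _ _ _ _ _ _ _ _ JD); rewrite lie_affine_field;
      affine_ring.
  have J2 : J 0 0 0 (- s) (- (4 * t)).
    by apply: (Jlie 0 1 0 0 0 _ _ _ _ _ _ _ _ _ _ J1); rewrite lie_affine_field;
      affine_ring.
  apply: (fromE (2 * t)); first by rewrite mulf_neq0.
  have := Jlin (-1) _ _ _ _ _ _ _ _ _ _ J2 J1.
  by rewrite /J; congr (I (psi (affine_field _ _ _ _ _ _))); ring.
case: (eqVneq c 0) IV => [->|c0] IV; last first.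
  right.
  have J1 : J 0 c 0 (- a) (- (2 * b)).
    by apply: (Jlie 0 0 0 0 1 _ _ _ _ _ _ _ _ _ _ IV); rewrite lie_affine_field;
      affine_ring.
  exact: fromH J1.
case: (eqVneq b 0) IV => [->|b0] IV; last by right; apply: fromH IV.
case: (eqVneq b' 0) IV => [->|b'0] IV; first by left; exists a, a'; rewrite oppr0.
right.
have J1 : J (- a') (- b') 0 0 0.
  by apply: (Jlie 0 0 1 0 0 _ _ _ _ _ _ _ _ _ _ IV); rewrite lie_affine_field;
    affine_ring.
by apply: fromH J1; rewrite oppr_eq0.
Qed.

(** The translations form an abelian ideal. A larger ideal would be the whole
    algebra, which is perfect and not zero, hence not solvable. *)
Lemma rad_param V : lie_rad (lie_derived M) V <-> param_translation V.
Proof.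
have trans_saff W : param_translation W -> param_saff W.
  by move=> [a [b ->]]; exists a, 0, 0, b, 0; rewrite oppr0.
split.
  apply: lspan_min => [|W [I [[subI IL stab] [n solvI] IW]]].
    exact: param_translation_subspace.
  have [] := @param_saff_ideal I W subI.
  - by move=> D E /derived_param LD; apply: stab.
  - exact/derived_param/IL.
  - by [].
  - by [].
  move=> saffI.
  have saff_iter m U : param_saff U -> iter m (@lie_derived K) I U.
    elim: m U => [|m IH] U SU /=; first exact: saffI.
    exact: (lie_derived_mono IH (param_saff_perfect SU)).
  have E0 : psi (affine_field 0 0 0 0 1 (- 0)) = 0.
    by apply/solvI/saff_iter; exists 0, 0, 0, 0, 1.
  case: psiP => _ _ inj _; have := inj _ (aff2_affine_field _ _ _ _ _ _) E0.
  move/(congr1 (fun D : Vec K => (dx D.2)@_0)) => /=.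
  have [_ -> _] := affine_comb_coef 0 1 (- 0).
  by rewrite dx0 mcoeff0 => /eqP; rewrite oner_eq0.
move=> TV; apply: lspan_mem; exists param_translation; split=> //.
- split; first exact: param_translation_subspace.
    by move=> D /trans_saff /derived_param.
  move=> D _ /derived_param [a [b [c [a' [b' ->]]]]] [p [q ->]].
  rewrite lie_param lie_affine_field; do 2 eexists.
  by congr (psi (affine_field _ _ _ _ _ _)); ring.
- exists 1%N => /= D; apply: (@lspan_min _ (fun D => D = 0)).
    by split=> // k U W -> ->; rewrite scaler0 addr0.
  move=> _ [_ [_ [[a [b ->]] [p [q ->]] ->]]].
  rewrite lie_param lie_affine_field -param0 -affine_field0.
  by congr psi; affine_ring.
Qed.

End FixedIsomorphism.

(** * The image of the affine algebra under an etale map *)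

(** With alpha = (f, g), the fields d/dx and d/dy go to - D_g / c and D_f / c, and the
    coordinate functions x and y to f and g. *)
Lemma etale_image f g c : c != 0 -> wedge (ham f) (ham g) = c%:MP ->
  exists alpha : {lrmorphism Poly2 K -> Poly2 K},
    [/\ alpha (vx K) = f, alpha (vy K) = g, etale alpha &
        forall V, affine_frame f g (ham f) (ham g) V <-> vimage alpha (aff2 K) V].
Proof.
move=> c0 wc.
pose alpha : {lrmorphism Poly2 K -> Poly2 K} := comp_mpoly [tuple f; g].
have ax : alpha (vx K) = f by rewrite /alpha /= /vx comp_mpolyXU.
have ay : alpha (vy K) = g by rewrite /alpha /= /vy comp_mpolyXU.
have jc : jac alpha = c%:MP by rewrite -wc /jac ax ay /wedge /=; ring.
exists alpha; split=> //; first by exists c.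
have jVc : (jac alpha)^-1 = (c^-1)%:MP.
  by rewrite jc rmorphV // unitfE.
have alphaE a b d : alpha (affine_comb (vx K) (vy K) a b d) = affine_comb f g a b d.
  rewrite /affine_comb !rmorphD !rmorphM /= ax ay.
  by rewrite /alpha /= !comp_mpolyC.
have vmapE a b d a' b' d' : vmap alpha (affine_field a b d a' b' d') =
    pscale (affine_comb f g (c^-1 * a') (c^-1 * b') (c^-1 * d')) (ham f) +
    pscale (affine_comb f g (- (c^-1 * a)) (- (c^-1 * b)) (- (c^-1 * d))) (ham g).
  rewrite /vmap jVc ax ay /= !alphaE.
  by apply: vec_eq; rewrite /= /affine_comb; ring.
move=> V; split.
  move=> [a [b [d [a' [b' [d' ->]]]]]].
  exists (affine_field (- (c * a')) (- (c * b')) (- (c * d')) (c * a) (c * b) (c * d)).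
    exact: aff2_affine_field.
  rewrite vmapE;
    congr (pscale (affine_comb _ _ _ _ _) _ + pscale (affine_comb _ _ _ _ _) _);
    by field.
move=> [D /(aff2P _ charK) [a [b [d [a' [b' [d' ->]]]]]] ->].
by rewrite vmapE; do 6 eexists.
Qed.

End Parametrization.
End Calculus.

Theorem proposition3p6 (K : closedFieldType) (charK : [pchar K] =i pred0)
    (M : Vec K -> Prop) (lieM : lie_subalgebra M)
    (divM : forall D, M D -> Vecc D) (isoM : lie_isomorphic M (aff2 K)) :
  (exists alpha : {lrmorphism Poly2 K -> Poly2 K},
      etale alpha /\ (forall D, M D <-> vimage alpha (aff2 K) D)) /\
  (forall f g : Poly2 K,
      is_basis [tuple ham f; ham g] (lie_rad (lie_derived M)) ->
      (forall D, M D <->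
         lspan_seq [:: ham f; ham g; pscale f (ham f); pscale g (ham g);
                   pscale g (ham f); pscale f (ham g)] D) /\
      exists alpha : {lrmorphism Poly2 K -> Poly2 K},
        [/\ alpha (vx K) = f, alpha (vy K) = g, etale alpha &
            forall D, M D <-> vimage alpha (aff2 K) D]).
Proof.
have [psi psiP] := aff2_param_exists charK lieM isoM.
have [f0 [g0 [c0 [c00 Af Bg w0]]]] := param_nondegenerate charK psiP divM.
have M0 := param_frame charK psiP c00 Af Bg w0.
split.
  have [alpha [_ _ et im]] := etale_image charK c00 w0.
  by exists alpha; split=> // D; rewrite M0.
move=> f g [_ radE].
have rad0 V : lie_rad (lie_derived M) V <-> lspan_seq [:: ham f0; ham g0] V.
  rewrite (rad_param charK psiP) lspan_pair -Af -Bg; split=> -[a [b ->]];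
    exists a, b; rewrite -!(paramZ psiP) -(paramD psiP); congr psi;
    by apply: vec_eq; rewrite /= /affine_comb -!mul_mpolyC; ring.
have spanE V : lspan_seq [:: ham f; ham g] V <-> lspan_seq [:: ham f0; ham g0] V.
  by rewrite -rad0 radE.
have [mf mg] := lspan_pair_mem (ham f) (ham g).
have [mf0 mg0] := lspan_pair_mem (ham f0) (ham g0).
have ff : lspan_seq [:: ham f0; ham g0] (ham f) by exact: (spanE _).1 mf.
have gg : lspan_seq [:: ham f0; ham g0] (ham g) by exact: (spanE _).1 mg.
have ff0 : lspan_seq [:: ham f; ham g] (ham f0) by exact: (spanE _).2 mf0.
have gg0 : lspan_seq [:: ham f; ham g] (ham g0) by exact: (spanE _).2 mg0.
have ME V : M V <-> affine_frame f g (ham f) (ham g) V.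
  by rewrite M0; split; apply: affine_frame_change.
have wedge_lin (U W : Vec K) a b a' b' :
    wedge (a *: U + b *: W) (a' *: U + b' *: W) = (a * b' - a' * b)%:MP * wedge U W.
  by rewrite /wedge /= -!mul_mpolyC; ring.
(* The Jacobian changes by the determinant of the base change, which is not zero
   because the base change can be undone. *)
have [c c_neq0 wc] : exists2 c : K, c != 0 & wedge (ham f) (ham g) = c%:MP.
  move/lspan_pair: ff => [a [b Ef]]; move/lspan_pair: gg => [a' [b' Eg]].
  exists ((a * b' - a' * b) * c0); last by rewrite Ef Eg wedge_lin w0 mpolyCM.
  apply/eqP => wz; move/lspan_pair: ff0 => [k [l Ef0]].
  move/lspan_pair: gg0 => [k' [l' Eg0]].
  have wfg : wedge (ham f) (ham g) = 0 by rewrite Ef Eg wedge_lin w0 -mpolyCM wz mpolyC0.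
  move: w0; rewrite Ef0 Eg0 wedge_lin wfg mulr0 => /esym/eqP.
  by rewrite mpolyC_eq0 (negPf c00).
have [alpha [ax ay et im]] := etale_image charK c_neq0 wc.
split=> [D|]; first by rewrite ME; apply: affine_frame_span.
by exists alpha; split=> // D; rewrite ME.
Qed.
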